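(* Consider the ATP problem with identical request distributions $\mathcal D_1=\dots=\mathcal D_T=\mathcal D$ (of finite support) and initial inventory $B_0\ge 1$. (a) There is an absolute constant $C>0$ such that for every such instance with $B_0\ge 2$ there exists an online algorithm whose expected profit is at least $\left(1-C\,\frac{\log B_0}{\sqrt{B_0}}\right)$ times the expected profit of the optimal offline algorithm. (b) There are absolute constants $c>0$ and $n_0$ such that for every integer $B_0\ge n_0$ there is such an instance with initial inventory $B_0$, whose optimal offline algorithm has positive expected profit $\mathrm{OPT}$, and on which every online algorithm has expected profit at most $\left(1-\frac{c}{\sqrt{B_0}}\right)\mathrm{OPT}$.
   Context: ATP (Asymmetric Trading Prophets) problem. A decision maker interacts with $T$ sequentially arriving requests to trade copies of a product. She has capacity $B\ge 1$ (she may hold at most $B$ copies at any time) and starts with an initial inventory of $B_0\in\{0,\dots,B\}$ copies. It is assumed throughout that $T\ge B_0$ and $B\le B_0+T$. At time $t\in\{1,\dots,T\}$ a price tuple $(b_t,s_t)$ is revealed, with $b_t\in[0,+\infty]$ (the cost of buying a copy; $b_t=+\infty$ means buying is impossible) and $s_t\in[0,\infty)$ (the revenue from selling a copy); $(b_t,s_t)$ is drawn from a known distribution $\mathcal D_t$, independently across $t$, while $b_t$ and $s_t$ may be arbitrarily correlated with each other. At time $t$ she takes exactly one action: Buy one copy at price $b_t$ (allowed if she holds at most $B-1$ copies), Sell one copy at price $s_t$ (allowed if she holds at least one copy), or Skip. Profit is total revenue from sales minus total cost of purchases. An online algorithm (possibly randomized) chooses its action at time $t$ knowing only the distributions, the tuples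 revealed up to and including time $t$, and its past actions. The optimal offline algorithm knows all realized tuples in advance and attains the maximum possible profit for each realization; its expected profit is the expectation of this maximum. *)

(* Defs.v *)
From HB Require Import structures.
From mathcomp Require Import all_boot all_order all_algebra.
From mathcomp Require Import reals constructive_ereal exp.

Set Implicit Arguments.
Unset Strict Implicit.
Unset Printing Implicit Defensive.

Import Order.TTheory GRing.Theory Num.Theory.
Local Open Scope ring_scope.

Inductive action := Buy | Sell | Skip.

Definition action_code (a : action) : option bool :=
  match a with Buy => Some true | Sell => Some false | Skip => None end.
Definition action_decode (x : option bool) : action :=
  match x with Some true => Buy | Some false => Sell | None => Skip end.
Lemma action_codeK : cancel action_code action_decode.
Proof. by case. Qed.
HB.instance Definition _ := Finite.copy action (can_type action_codeK).

(* [(b, s)]: [b = +oo] means that buying is impossible. *)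
Definition price_tuple (R : realType) : Type := (\bar R * R)%type.

(* The common law of the requests is [\sum_i mass i * dirac (price i)]. *)
Record iid_instance (R : realType) := IidInstance {
  horizon : nat;
  capacity : nat;
  init : nat;
  nsupp : nat;
  price : 'I_nsupp -> price_tuple R;
  mass : 'I_nsupp -> R;
  price_inj : injective price;
  buy_price_ge0 : forall i, (0 <= (price i).1)%E;
  sell_price_ge0 : forall i, 0 <= (price i).2;
  mass_gt0 : forall i, 0 < mass i;
  mass_sum1 : \sum_i mass i = 1;
  capacity_ge1 : (1 <= capacity)%N;
  init_ge1 : (1 <= init)%N;
  init_le_capacity : (init <= capacity)%N;
  init_le_horizon : (init <= horizon)%N;
  capacity_le : (capacity <= init + horizon)%N
}.

Section Play.
Variable R : realType.

Definition history := seq (price_tuple R * action).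

Definition next_stock (k : nat) (a : action) : nat :=
  match a with Buy => k.+1 | Sell => k.-1 | Skip => k end.

Definition stock (k : nat) (h : history) : nat :=
  foldl (fun k x => next_stock k x.2) k h.

Definition allowed (B k : nat) (p : price_tuple R) (a : action) : bool :=
  match a with
  | Buy => (k < B)%N && (p.1 < +oo)%E
  | Sell => (0 < k)%N
  | Skip => true
  end.

Fixpoint feasible (B k : nat) (h : history) : bool :=
  if h is (p, a) :: h' then allowed B k p a && feasible B (next_stock k a) h'
  else true.

(* [fine +oo = 0] is never used: [allowed] forbids buying at price [+oo]. *)
Definition gain (p : price_tuple R) (a : action) : R :=
  match a with Buy => - fine p.1 | Sell => p.2 | Skip => 0 end.

Definition profit (h : history) : R := \sum_(x <- h) gain x.1 x.2.

End Play.

Section Algorithms.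
Variables (R : realType) (I : iid_instance R).

(* A randomized online algorithm: [act_prob h p a] is the conditional chance
   of playing [a] when the past tuples and actions are [h] and the tuple just
   revealed is [p]; the current time is [(size h).+1]. *)
Record online_alg := OnlineAlg {
  act_prob : history R -> price_tuple R -> action -> R;
  act_prob_ge0 : forall h p a, 0 <= act_prob h p a;
  act_prob_sum1 : forall h p, \sum_a act_prob h p a = 1;
  act_prob_allowed : forall h p a,
    ~~ allowed (capacity I) (stock (init I) h) p a -> act_prob h p a = 0
}.

Definition scenario := (horizon I).-tuple 'I_(nsupp I).
Definition actions := (horizon I).-tuple action.

Definition scenario_prob (w : scenario) : R :=
  \prod_(t < horizon I) mass (tnth w t).

Definition play (w : scenario) (a : actions) : history R :=
  zip [seq price i | i <- w] a.

Definition actions_prob (A : online_alg) (w : scenario) (a : actions) : R :=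
  \prod_(t < horizon I)
    act_prob A (take t (play w a)) (price (tnth w t)) (tnth a t).

Definition expected_profit (A : online_alg) : R :=
  \sum_(w : scenario) scenario_prob w *
    \sum_(a : actions) actions_prob A w a * profit (play w a).

(* Starting the maximum at 0 changes nothing: always skipping is feasible and
   has profit 0. *)
Definition offline_profit (w : scenario) : R :=
  \big[Num.max/0]_(a : actions | feasible (capacity I) (init I) (play w a))
    profit (play w a).

Definition expected_offline_profit : R :=
  \sum_(w : scenario) scenario_prob w * offline_profit w.

End Algorithms.

(* Main.v *)
Require Import Defs.
From mathcomp Require Import all_boot all_order all_algebra.
From mathcomp Require Import reals constructive_ereal exp.
From mathcomp Require Import zify ring lra.
Import Order.TTheory GRing.Theory Num.Theory.
Set Implicit Arguments.
Unset Strict Implicit.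
Unset Printing Implicit Defensive.
Local Open Scope ring_scope.

(** (a) Average over time the chances that an optimal offline algorithm buys or
    sells at a given price tuple. An online algorithm that wants to trade at
    these rates splits its sales in two: some are matched with the purchases
    through a buffer of about [sqrt B0] copies, the others drain a reserve of
    [B0 - sqrt B0] copies. Started uniformly, the buffer level stays uniform, so
    it refuses only a fraction [1 / sqrt B0] of the matched trades. The reserve
    faces a binomial number of sales of mean at most [B0], so Chebyshev-type
    bounds make it lose a fraction [O(1 / sqrt B0)]. This beats the claimed rate
    by the logarithm. Since the online optimum is Markovian, the random hidden
    state of this algorithm need not be encoded: it only provides a lower bound
    on the dynamic programming value.

    (b) Buying is impossible, sales pay 2 with probability 1/2, pay 1 with
    probability of order [1 / sqrt B0], and pay 0 otherwise; [T = 2 B0]. About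
    [sqrt B0] requests of price 1 come in a first short phase. With constant
    probability the requests of price 2 exhaust the inventory, and then each
    early sale at price 1 is a loss; with constant probability they leave so
    many copies that each refusal of an early sale at price 1 is a loss. Hence
    the regret has order [sqrt B0], while the optimum is at most [2 B0]. *)

(** * Expectations over request sequences *)

Lemma big_tuple0 (R : nmodType) (T : finType) (F : 0.-tuple T -> R) :
  \sum_(w : 0.-tuple T) F w = F [tuple].
Proof.
rewrite (bigD1 [tuple]) //= big1 ?addr0 // => w /negP[].
by rewrite (tuple0 w).
Qed.

Lemma big_tuple_cons (R : nmodType) (T : finType) n (F : n.+1.-tuple T -> R) :
  \sum_(w : n.+1.-tuple T) F w = \sum_i \sum_(w : n.-tuple T) F [tuple of i :: w].
Proof.
rewrite pair_big /=.
rewrite (reindex (fun p : T * n.-tuple T => [tuple of p.1 :: p.2])) //=.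
exists (fun w : n.+1.-tuple T => (thead w, [tuple of behead w])) => [[i w] _|w _] /=.
  by congr pair; apply: val_inj.
by rewrite -tuple_eta.
Qed.

Section Expectation.
Variables (R : realFieldType) (k : nat) (mass : 'I_k -> R).

(** Recursion on the first request makes conditioning on it immediate; plain sequences let a run be
    cut into phases without casts. *)
Fixpoint expect n (F : seq 'I_k -> R) : R :=
  if n is n'.+1 then \sum_i mass i * expect n' (fun w => F (i :: w)) else F [::].

Lemma expect_tuple n (F : seq 'I_k -> R) :
  \sum_(w : n.-tuple 'I_k) (\prod_(t < n) mass (tnth w t)) * F w = expect n F.
Proof.
elim: n F => [|n IH] F; first by rewrite big_tuple0 big_ord0 mul1r.
rewrite big_tuple_cons /=; apply: eq_bigr => i _.
rewrite -IH mulr_sumr; apply: eq_bigr => w _.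
rewrite big_ord_recl tnth0 mulrA; congr (_ * _ * _).
by apply: eq_bigr => t _; rewrite tnthS.
Qed.

Hypothesis mass_ge0 : forall i, 0 <= mass i.
Hypothesis mass_sum1 : \sum_i mass i = 1.

Lemma expect_cst n c : expect n (fun _ => c) = c.
Proof. by elim: n => //= n ->; rewrite -mulr_suml mass_sum1 mul1r. Qed.

Lemma expectD n F G : expect n (fun w => F w + G w) = expect n F + expect n G.
Proof.
elim: n F G => //= n IH F G; rewrite -big_split; apply: eq_bigr => i _.
by rewrite IH mulrDr.
Qed.

Lemma expectZ n c F : expect n (fun w => c * F w) = c * expect n F.
Proof.
elim: n F => //= n IH F; rewrite mulr_sumr; apply: eq_bigr => i _.
by rewrite IH mulrCA.
Qed.

Lemma eq_expect n F G : (forall w, size w = n -> F w = G w) -> expect n F = expect n G.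
Proof.
elim: n F G => [|n IH] F G FG /=; first exact: FG.
by apply: eq_bigr => i _; congr (_ * _); apply: IH => w sw; apply: FG; rewrite /= sw.
Qed.

Lemma expectB n F G : expect n (fun w => F w - G w) = expect n F - expect n G.
Proof.
rewrite -mulN1r -expectZ -expectD; apply: eq_expect => w _; by rewrite mulN1r.
Qed.

Lemma le_expect n F G :
  (forall w, size w = n -> F w <= G w) -> expect n F <= expect n G.
Proof.
elim: n F G => [|n IH] F G FG /=; first exact: FG.
apply: ler_sum => i _; apply: ler_wpM2l => //.
by apply: IH => w sw; apply: FG; rewrite /= sw.
Qed.

Lemma expect_cat n1 n2 F :
  expect (n1 + n2) F = expect n1 (fun u => expect n2 (fun v => F (u ++ v))).
Proof. by elim: n1 F => //= n1 IH F; apply: eq_bigr => i _; rewrite IH. Qed.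

Lemma expect_count n i : expect n (fun w => (count_mem i w)%:R) = n%:R * mass i.
Proof.
elim: n => [|n IH]; first by rewrite mul0r.
rewrite /= (bigD1 i) //= eqxx.
under eq_bigr => j /negbTE ji.
  rewrite ji (_ : expect _ _ = n%:R * mass i); first over.
  by rewrite -IH.
rewrite -mulr_suml.
under eq_expect => w _ do rewrite natrD.
rewrite expectD expect_cst IH.
have := mass_sum1; rewrite (bigD1 i) //=.
set s := bigop _ _ _ => e; rewrite mulrDr mulr1 -addrA -mulrDl e.
by rewrite -natr1; ring.
Qed.

(* Centred increments: the cross terms vanish. *)
Lemma expect_sqr_sum n (c : 'I_k -> R) x :
  \sum_i mass i * c i = 0 ->
  expect n (fun w => (\sum_(i <- w) c i + x) ^+ 2) =
  n%:R * (\sum_i mass i * c i ^+ 2) + x ^+ 2.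
Proof.
move=> c0; elim: n x => [|n IH] x; first by rewrite /= big_nil add0r mul0r add0r.
rewrite /=.
under eq_bigr => i _.
  rewrite (_ : expect _ _ = n%:R * (\sum_i mass i * c i ^+ 2) + (x ^+ 2 + (2 * x) * c i + c i ^+ 2)).
    over.
  rewrite (_ : x ^+ 2 + _ + _ = (c i + x) ^+ 2); last by ring.
  by rewrite -IH; apply: eq_expect => w _; rewrite big_cons; ring.
under eq_bigr => i _ do rewrite mulrDr mulrDr mulrDr (mulrCA _ (2 * x)).
rewrite !big_split /= -!mulr_suml -mulr_sumr mass_sum1 c0.
by rewrite -natr1; ring.
Qed.

(** Markov's inequality; with a squared deviation as [F] it becomes Chebyshev's. *)
Lemma expect_markov n (P : seq 'I_k -> bool) F a :
  0 < a -> (forall w, size w = n -> 0 <= F w) ->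
  (forall w, size w = n -> P w -> a <= F w) ->
  expect n (fun w => (P w)%:R) <= expect n F / a.
Proof.
move=> a0 F0 FP; rewrite ler_pdivlMr // mulrC -expectZ.
apply: le_expect => w sw; case: (P w) (FP w sw) => [/(_ isT)|_].
  by rewrite mulr1.
by rewrite mulr0 F0.
Qed.

End Expectation.

(** * The value of online algorithms *)

Section OnlineValue.
Variables (R : realType) (I : iid_instance R).
Implicit Types (A : online_alg I) (h : history R).
Local Notation T := (horizon I).
Local Notation B := (capacity I).

(** Expected profit of [A] over the next [n] requests, given the history [h]. *)
Fixpoint value A n h : R :=
  if n is n'.+1 then
    \sum_(i < nsupp I) mass i * \sum_a act_prob A h (price i) a *
      (gain (price i) a + value A n' (rcons h (price i, a)))
  else 0.

Let play_prob A n h (w : n.-tuple 'I_(nsupp I)) (a : n.-tuple action) : R :=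
  \prod_(t < n) act_prob A (h ++ take t (zip [seq price i | i <- w] a))
                  (price (tnth w t)) (tnth a t).

Let play_prob_cons A n h i x (w : n.-tuple 'I_(nsupp I)) (a : n.-tuple action) :
  play_prob A h [tuple of i :: w] [tuple of x :: a] =
  act_prob A h (price i) x * play_prob A (rcons h (price i, x)) w a.
Proof.
rewrite /play_prob big_ord_recl !tnth0 take0 cats0; congr (_ * _).
by apply: eq_bigr => t _; rewrite !tnthS /= cat_rcons.
Qed.

Let play_prob_sum1 A n h (w : n.-tuple 'I_(nsupp I)) :
  \sum_a play_prob A h w a = 1.
Proof.
elim: n h w => [|n IH] h w; first by rewrite big_tuple0 /play_prob big_ord0.
rewrite (tuple_eta w) big_tuple_cons.
under eq_bigr => x _.
  under eq_bigr => a _ do rewrite play_prob_cons.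
  rewrite -mulr_sumr IH mulr1.
  over.
exact: act_prob_sum1.
Qed.

(** Condition on the first round: the chances of the later actions sum to 1, so its gain is weighted
    by its own chance alone, and the later rounds form the same expectation with a longer
    history. *)
Lemma expected_profitE A : expected_profit A = value A T [::].
Proof.
suff E n h : \sum_(w : n.-tuple 'I_(nsupp I)) (\prod_(t < n) mass (tnth w t)) *
    \sum_(a : n.-tuple action) play_prob A h w a *
      profit (zip [seq price i | i <- w] a) = value A n h by rewrite -E.
elim: n h => [|n IH] h.
  by rewrite !big_tuple0 /profit big_nil !mulr0.
rewrite big_tuple_cons /=; apply: eq_bigr => i _.
under eq_bigr => w _.
  rewrite big_ord_recl tnth0.
  under [X in _ * X * _]eq_bigr => t _ do rewrite tnthS.
  rewrite big_tuple_cons -mulrA.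
  under [X in mass i * (_ * X)]eq_bigr => x _.
    under eq_bigr => a _.
      rewrite play_prob_cons /profit big_cons -/(profit (zip _ _)) mulrDr.
      rewrite mulrAC.
      over.
    rewrite big_split /= -mulr_sumr play_prob_sum1 mulr1.
    under [X in _ + X]eq_bigr => a _ do rewrite -mulrA.
    rewrite -mulr_sumr -mulrDr.
    over.
  over.
rewrite -mulr_sumr; congr (_ * _).
under [LHS]eq_bigr => w _ do rewrite mulr_sumr.
rewrite exchange_big /=; apply: eq_bigr => x _.
under [LHS]eq_bigr => w _ do rewrite mulrCA mulrDr.
rewrite -mulr_sumr big_split /= IH -mulr_suml; congr (_ * (_ + _)).
have /= := @expect_tuple _ _ (@mass _ I) n (fun=> 1).
under eq_bigr do rewrite mulr1.
by move=> ->; rewrite expect_cst ?mul1r // mass_sum1.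
Qed.

Definition best (V : nat -> R) (k : nat) (p : price_tuple R) : action :=
  [arg max_(a > Skip | allowed B k p a) (gain p a + V (next_stock k a))]%O.

(** The Bellman recursion. Since requests are independent, the stock and the number of requests left
    suffice as state. *)
Fixpoint opt_value n (k : nat) : R :=
  if n is n'.+1 then
    \sum_(i < nsupp I) mass i * (let a := best (opt_value n') k (price i) in
      gain (price i) a + opt_value n' (next_stock k a))
  else 0.

Lemma best_allowed V k p : allowed B k p (best V k p).
Proof. by rewrite /best; case: arg_maxP. Qed.

Lemma best_ge V k p a : allowed B k p a ->
  gain p a + V (next_stock k a) <=
  gain p (best V k p) + V (next_stock k (best V k p)).
Proof. by rewrite /best; case: arg_maxP => //= a0 _; apply. Qed.

Definition opt_act (h : history R) (p : price_tuple R) : action :=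
  best (opt_value (T - (size h).+1)) (stock (init I) h) p.

Let opt_prob h p a : R := (a == opt_act h p)%:R.

Let opt_prob_ge0 h p a : 0 <= opt_prob h p a.
Proof. exact: ler0n. Qed.

Let opt_prob_sum1 h p : \sum_a opt_prob h p a = 1.
Proof.
rewrite (bigD1 (opt_act h p)) //= /opt_prob eqxx big1 ?addr0 // => a.
by move=> /negbTE ->.
Qed.

Let opt_prob_allowed h p a :
  ~~ allowed B (stock (init I) h) p a -> opt_prob h p a = 0.
Proof.
rewrite /opt_prob; case: eqP => // -> /negP[].
exact: best_allowed.
Qed.

Definition opt_alg : online_alg I :=
  OnlineAlg opt_prob_ge0 opt_prob_sum1 opt_prob_allowed.

Lemma stock_rcons k h x : stock k (rcons h x) = next_stock (stock k h) x.2.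
Proof. by rewrite /stock foldl_rcons. Qed.

Lemma expected_profit_opt : expected_profit opt_alg = opt_value T (init I).
Proof.
rewrite expected_profitE.
suff E n h : (size h + n = T)%N -> value opt_alg n h = opt_value n (stock (init I) h).
  exact: E.
elim: n h => //= n IH h sh; apply: eq_bigr => i _; congr (_ * _).
rewrite (bigD1 (opt_act h (price i))) //= /opt_prob eqxx mul1r big1 ?addr0; last first.
  by move=> a /negbTE ->; rewrite mul0r.
rewrite IH; last by rewrite size_rcons; lia.
by rewrite stock_rcons /opt_act; have -> : (T - (size h).+1 = n)%N by lia.
Qed.

(** A randomized action averages over allowed actions, none of which beats [best]; forbidden ones
    have chance 0. *)
Lemma expected_profit_le_opt A : expected_profit A <= opt_value T (init I).
Proof.
rewrite expected_profitE.
suff E n h : value A n h <= opt_value n (stock (init I) h) by exact: E.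
elim: n h => //= n IH h; apply: ler_sum => i _.
apply: ler_wpM2l; first exact/ltW/mass_gt0.
rewrite -[leRHS]mul1r -(act_prob_sum1 A h (price i)) mulr_suml.
apply: ler_sum => a _.
have [al|nal] := boolP (allowed B (stock (init I) h) (price i) a); last first.
  by rewrite act_prob_allowed // !mul0r.
apply: ler_wpM2l; first exact: act_prob_ge0.
apply: le_trans (best_ge (opt_value n) al).
by rewrite lerD2l; apply: le_trans (IH _) _; rewrite stock_rcons.
Qed.

Lemma opt_value_ge0 n k : 0 <= opt_value n k.
Proof.
elim: n k => //= n IH k; apply: sumr_ge0 => i _.
apply: mulr_ge0; first exact/ltW/mass_gt0.
apply: le_trans (best_ge (opt_value n) (a := Skip) _) => //=.
by rewrite add0r.
Qed.

End OnlineValue.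

(** * Buffer and reserve *)

Section Buffer.
Variables (R : realFieldType) (W : nat) (p X Y : R).

(** Expected profit from level [u] when a purchase and a sale are each attempted with chance [p] per
    round; [X] and [Y] are the cost and revenue per round, already weighted by these chances. *)
Fixpoint buffer n (u : nat) : R :=
  if n is n'.+1 then
    buffer n' u
    + (u.+1 < W)%N%:R * (p * (buffer n' u.+1 - buffer n' u) - X)
    + (0 < u)%N%:R * (p * (buffer n' u.-1 - buffer n' u) + Y)
  else 0.

(* The uniform law on the levels is stationary, and in it each request is
   refused with probability [1 / W]. *)
Lemma sum_buffer n : \sum_(u < W) buffer n u = n%:R * (W.-1)%:R * (Y - X).
Proof.
elim: n => [|n IH] /=; first by rewrite big1 // !mul0r.
rewrite !big_split /= IH; case: (W) => [|w]; first by rewrite !big_ord0 !mulr0 !mul0r !addr0.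
(* Only the top level refuses purchases and only level 0 refuses sales. Re-indexing pairs a purchase
   at [u] with a sale at [u.+1], and their [p]-terms cancel. *)
rewrite [X in _ + X + _]big_ord_recr [X in _ + X]big_ord_recl /= !ltnn !mul0r add0r addr0.
rewrite -addrA -big_split /=.
under eq_bigr => u _.
  rewrite /bump leq0n add1n add0n ltnS ltn_ord /= !mul1r (_ : _ - X + _ = Y - X); last by ring.
  over.
rewrite sumr_const card_ord -natr1 -mulr_natl; ring.
Qed.

End Buffer.

Section Reserve.
Variables (R : realFieldType) (r Z : R).

(** Expected revenue from [a] copies when a sale is attempted with chance [r] per round; [Z] is
    already weighted by the chances. *)
Fixpoint reserve n (a : nat) : R :=
  if n is n'.+1 then
    reserve n' a + (0 < a)%N%:R * (r * (reserve n' a.-1 - reserve n' a) + Z)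
  else 0.

Hypotheses (r_le1 : r <= 1) (Z_ge0 : 0 <= Z).

Lemma reserve0 n : reserve n 0 = 0.
Proof. by elim: n => //= n ->; rewrite mul0r addr0. Qed.

(* [(y + c)^2 / (4 c)] dominates the positive part of [y], and the binomial
   number of attempted sales has mean [n r] and variance [n r (1 - r)]. *)
Lemma reserve_ge c n a : 0 < r -> 0 < c ->
  Z * (n%:R - (n%:R * r * (1 - r) + (n%:R * r - a%:R + c) ^+ 2) / (4 * c * r))
  <= reserve n a.
Proof.
move=> r0 c0; have r_ge0 := ltW r0; have d0 : 0 < 4 * c * r by rewrite !mulr_gt0.
elim: n a => [|n IH] a.
  rewrite !mul0r !add0r mulr_ge0_le0 // oppr_le0.
  by rewrite divr_ge0 ?sqr_ge0 // ltW.
case: a => [|a] /=.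
  (* An empty reserve earns nothing; there [(y + c)^2 >= 4 c y] with [y = n.+1 r] makes the bound
     nonpositive. *)
  rewrite reserve0 mul0r addr0 mulr_ge0_le0 // subr_le0 ler_pdivlMr //.
  have n0 : 0 <= n.+1%:R :> R by [].
  have : 0 <= n.+1%:R * r * (1 - r) by rewrite !mulr_ge0 // subr_ge0.
  by have := sqr_ge0 (n.+1%:R * r - c); nra.
rewrite mul1r.
have IHa := IH a; have IHb := IH a.+1.
(* Away from the empty reserve the bound satisfies the recursion of [reserve] with equality, as
   [field] checks below. *)
have H : (1 - r) * (Z * (n%:R - (n%:R * r * (1 - r) + (n%:R * r - a.+1%:R + c) ^+ 2) / (4 * c * r))) +
  r * (Z * (n%:R - (n%:R * r * (1 - r) + (n%:R * r - a%:R + c) ^+ 2) / (4 * c * r))) + Z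
  <= (1 - r) * reserve n a.+1 + r * reserve n a + Z.
  by rewrite lerD2r lerD // ler_wpM2l // subr_ge0.
apply: le_trans (le_trans _ H) _.
  rewrite -!natr1 le_eqVlt; apply/orP; left; apply/eqP.
  field.
  by rewrite !gt_eqF.
by rewrite le_eqVlt; apply/orP; left; apply/eqP; ring.
Qed.

Hypothesis r_ge0 : 0 <= r.

(** As [0 <= r <= 1], each step mixes values at neighbouring levels. Monotonicity allows [r] to
    overestimate the rate of sales. *)
Lemma reserve_le n a : reserve n a <= reserve n a.+1.
Proof.
elim: n a => //= n IH [|a] /=.
  rewrite mul0r addr0 mul1r.
  have : 0 <= (1 - r) * (reserve n 1 - reserve n 0) by rewrite mulr_ge0 // subr_ge0.
  move=> H; have := Z_ge0; nra.
rewrite !mul1r.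
have : 0 <= (1 - r) * (reserve n a.+2 - reserve n a.+1) by rewrite mulr_ge0 // subr_ge0.
have : 0 <= r * (reserve n a.+1 - reserve n a) by rewrite mulr_ge0 // subr_ge0.
lra.
Qed.

End Reserve.

(** * Running buffer and reserve together inside the dynamic program *)

Section Plan.
Variables (R : realType) (I : iid_instance R).
Variables (x y z : 'I_(nsupp I) -> R) (r : R).
Local Notation T := (horizon I).
Local Notation B := (capacity I).
Local Notation buy i := (fine (price (i0 := I) i).1).
Local Notation sell i := ((price (i0 := I) i).2).

Hypotheses (x_ge0 : forall i, 0 <= x i) (y_ge0 : forall i, 0 <= y i).
Hypotheses (z_ge0 : forall i, 0 <= z i).
Hypothesis xyz_le : forall i, x i + y i + z i <= mass i.
Hypothesis x_fin : forall i, x i != 0 -> ((price i).1 < +oo)%E.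
Hypothesis xy_eq : \sum_i x i = \sum_i y i.
Hypotheses (z_le : \sum_i z i <= r) (r_le1 : r <= 1).

Let X := \sum_i x i * buy i.
Let Y := \sum_i y i * sell i.
Let Z := \sum_i z i * sell i.
Let p := \sum_i x i.

Let Z_ge0 : 0 <= Z.
Proof. by apply: sumr_ge0 => i _; rewrite mulr_ge0 // sell_price_ge0. Qed.

Let r_ge0 : 0 <= r.
Proof. by apply: le_trans z_le; apply: sumr_ge0. Qed.

(* [u] copies are held in a buffer of capacity [W - 1] serving the buys [x] and
   the sales [y], and [a] copies in a reserve serving the sales [z]; copies in
   excess of [u + a] replace future purchases. *)
Lemma buffer_reserve_le_opt W n k u a :
  (u < W)%N -> (u + a <= k)%N -> (k <= B)%N -> (W + a <= B)%N ->
  buffer W p X Y n u + reserve r Z n a <= opt_value I n k.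
Proof.
elim: n k u a => [|n IH] k u a uW uak kB WaB; first by rewrite /= addr0.
pose f := buffer W p X Y n; pose g := reserve r Z n.
pose V (i : 'I_(nsupp I)) := gain (price i) (best I (opt_value I n) k (price i)) +
  opt_value I n (next_stock k (best I (opt_value I n) k (price i))).
have skipV i : f u + g a <= V i.
  by apply: le_trans (best_ge (opt_value I n) (a := Skip) _) => //=; rewrite add0r IH.
have buyV i : x i * (f u + g a + (u.+1 < W)%N%:R * (f u.+1 - f u - buy i)) <= x i * V i.
  have [->|/x_fin pf] := eqVneq (x i) 0; first by rewrite !mul0r.
  apply: ler_wpM2l => //; case uW' : (u.+1 < W)%N; last by rewrite mul0r addr0.
  rewrite mul1r; have b0 : 0 <= buy i by rewrite fine_ge0 // buy_price_ge0.
  have [kua|kua] := eqVneq k (u + a)%N; last first.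
    apply: le_trans (best_ge (opt_value I n) (a := Skip) _) => //=; rewrite add0r.
    have := @IH k u.+1 a uW' ltac:(lia) kB WaB; rewrite -/(f _) -/(g _); lra.
  (* There is room for a real purchase: [k = u + a], [u.+1 < W] and [W + a <= B] give [k < B]. *)
  apply: le_trans (best_ge (opt_value I n) (a := Buy) _) => //=; last first.
    by rewrite pf andbT; lia.
  have := @IH k.+1 u.+1 a uW' ltac:(lia) ltac:(lia) WaB; rewrite -/(f _) -/(g _); lra.
have bufV i : f u + g a + (0 < u)%N%:R * (f u.-1 - f u + sell i) <= V i.
  case u0 : (0 < u)%N; last by rewrite mul0r addr0.
  apply: le_trans (best_ge (opt_value I n) (a := Sell) _) => //=; last by lia.
  have := @IH k.-1 u.-1 a ltac:(lia) ltac:(lia) ltac:(lia) WaB; rewrite -/(f _) -/(g _); lra.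
have resV i : f u + g a + (0 < a)%N%:R * (g a.-1 - g a + sell i) <= V i.
  case a0 : (0 < a)%N; last by rewrite mul0r addr0.
  apply: le_trans (best_ge (opt_value I n) (a := Sell) _) => //=; last by lia.
  have := @IH k.-1 u a.-1 ltac:(lia) ltac:(lia) ltac:(lia) ltac:(lia); rewrite -/(f _) -/(g _); lra.
(* Mix the three trades with weights [x i], [y i], [z i], and Skip with the remaining mass: each
   branch is worth at most [V i]. *)
have stepV i : mass i * (f u + g a)
    + (u.+1 < W)%N%:R * (x i * (f u.+1 - f u) - x i * buy i)
    + (0 < u)%N%:R * (y i * (f u.-1 - f u) + y i * sell i)
    + (0 < a)%N%:R * (z i * (g a.-1 - g a) + z i * sell i) <= mass i * V i.
  have := buyV i; have := ler_wpM2l (y_ge0 i) (bufV i).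
  have := ler_wpM2l (z_ge0 i) (resV i).
  have : 0 <= mass i - x i - y i - z i by have := xyz_le i; lra.
  move=> /ler_wpM2l /(_ _ _ (skipV i)); lra.
have := ler_sum (index_enum _) (P := predT) (fun i _ => stepV i).
rewrite !big_split /= -!mulr_suml mass_sum1 -!mulr_sumr !big_split /= -!mulr_suml.
rewrite sumrN -xy_eq -/p -/X -/Y -/Z => sumV.
apply: le_trans sumV; rewrite -/f -/g mul1r.
(* The true drain rate is [\sum_i z i <= r]; losing a copy never raises [reserve], so [r] only
   lowers the bound. *)
suff : (0 < a)%N%:R * (r * (g a.-1 - g a)) <=
       (0 < a)%N%:R * ((\sum_i z i) * (g a.-1 - g a)) by lra.
apply: ler_wpM2l => //; case: a {uak WaB skipV buyV bufV resV stepV} => [|a] /=.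
  by rewrite subrr !mulr0.
by apply: ler_wnM2r => //; rewrite subr_le0 reserve_le.
Qed.

(** Setting [W] copies aside for the buffer makes every starting level [u < W] admissible, so the
    bound may be averaged over [u], where [sum_buffer] is exact. *)
Lemma plan_le_opt W : (0 < W <= init I)%N ->
  (T%:R * (1 - W%:R^-1)) * (Y - X) + reserve r Z T (init I - W)
    <= opt_value I T (init I).
Proof.
move=> /andP[W0 WB]; have Wr : 0 < W%:R :> R by rewrite ltr0n.
have iB := init_le_capacity I.
have H (u : 'I_W) : true -> buffer W p X Y T u + reserve r Z T (init I - W) <= opt_value I T (init I).
  by move=> _; apply: buffer_reserve_le_opt; have := ltn_ord u; lia.
have := ler_sum (index_enum _) H.
rewrite big_split /= sum_buffer !sumr_const card_ord.
rewrite -[in X in _ + X <= _]mulr_natl -[in X in _ <= X]mulr_natl => le.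
rewrite -(ler_pM2l Wr); apply: le_trans le; rewrite mulrDr lerD2r.
rewrite -subn1 natrB // le_eqVlt; apply/orP; left; apply/eqP; field.
by rewrite gt_eqF.
Qed.

End Plan.

(** * Marginals of the offline optimum *)

Lemma nat_sqrt n : exists q, (q ^ 2 <= n < q.+1 ^ 2)%N.
Proof.
elim: n => [|n [q /andP[qn nq]]]; first by exists 0%N.
have [?|?] := leqP (q.+1 ^ 2) n.+1; last by exists q; lia.
by exists q.+1; lia.
Qed.

Section OfflineMarginals.
Variables (R : realType) (I : iid_instance R).
Local Notation T := (horizon I).
Local Notation B := (capacity I).
Local Notation buy i := (fine (price (i0 := I) i).1).
Local Notation sell i := ((price (i0 := I) i).2).
Implicit Type l : seq ('I_(nsupp I) * action).

Let hist l : history R := [seq (price x.1, x.2) | x <- l].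

Lemma playE (w : scenario I) (a : actions I) : play w a = hist (zip w a).
Proof.
rewrite /play /hist.
by elim: (val w) (val a) => [|i s IH] [|x t] //=; rewrite IH.
Qed.

Let count_sum l x : (\sum_i count_mem (i, x) l = count (fun u => u.2 == x) l)%N.
Proof.
elim: l => [|[j y] l IH] /=; first by rewrite big1.
rewrite big_split /= IH; congr (_ + _)%N.
rewrite (bigD1 j) //= big1 => [|i /negbTE ij].
  by rewrite addn0 xpair_eqE eqxx.
by rewrite xpair_eqE eq_sym ij.
Qed.

Lemma profit_count l :
  profit (hist l) = \sum_i (count_mem (i, Sell) l)%:R * sell i
                  - \sum_i (count_mem (i, Buy) l)%:R * buy i.
Proof.
rewrite /profit /hist big_map.
elim: l => [|[j y] l IH] /=.
  by rewrite big_nil !big1 ?subrr // => i _; rewrite mul0r.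
rewrite big_cons IH /=.
have E x (g : 'I_(nsupp I) -> R) : \sum_i (((j, y) == (i, x)) + count_mem (i, x) l)%:R * g i =
    (y == x)%:R * g j + \sum_i (count_mem (i, x) l)%:R * g i.
  under eq_bigr do rewrite natrD mulrDl.
  rewrite big_split /=; congr (_ + _); rewrite (bigD1 j) //= big1 => [|i /negbTE ij].
    by rewrite addr0 xpair_eqE eqxx.
  by rewrite xpair_eqE eq_sym ij mul0r.
rewrite !E; case: y {E} => /=; ring.
Qed.

Lemma feasible_sell_le k l : feasible B k (hist l) ->
  (\sum_i count_mem (i, Sell) l <= k + \sum_i count_mem (i, Buy) l)%N.
Proof.
rewrite !count_sum; elim: l k => [|[j y] l IH] k //= /andP[al /IH].
by case: y al => /=; lia.
Qed.

Lemma feasible_buy_fin k l i : feasible B k (hist l) ->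
  (0 < count_mem (i, Buy) l)%N -> ((price i).1 < +oo)%E.
Proof.
elim: l k => [|[j y] l IH] k //= /andP[al /IH{}IH].
rewrite addn_gt0 lt0b xpair_eqE => /orP[|//] /andP[/eqP<- /eqP yb].
by move: al; rewrite yb => /andP[].
Qed.

Lemma count_buy_sell_le (w : scenario I) (a : actions I) i :
  (count_mem (i, Buy) (zip w a) + count_mem (i, Sell) (zip w a) <= count_mem i w)%N.
Proof.
elim: (val w) (val a) => [|j s IH] [|x t] //=.
have := IH t; rewrite !xpair_eqE; case: (j == i) => //=; case: x => /=; lia.
Qed.

Lemma offline_profit_ge0 (w : scenario I) : 0 <= offline_profit w.
Proof. exact: Order.TotalTheory.bigmax_ge_id. Qed.

Let skips : actions I := [tuple of nseq T Skip].

Let skips_feasible (w : scenario I) : feasible B (init I) (play w skips).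
Proof.
rewrite /play; move: (val w) => s /=; move: (init I) => k.
by elim: s T => [|i s IH] [|n] //=.
Qed.

Let offline_act (w : scenario I) : actions I :=
  [arg max_(a > skips | feasible B (init I) (play w a)) profit (play w a)]%O.

Let offline_act_feasible (w : scenario I) :
  feasible B (init I) (play w (offline_act w)).
Proof. by rewrite /offline_act; case: arg_maxP (skips_feasible w). Qed.

Let offline_profit_le (w : scenario I) :
  offline_profit w <= profit (play w (offline_act w)).
Proof.
have H a : feasible B (init I) (play w a) ->
    profit (play w a) <= profit (play w (offline_act w)).
  rewrite /offline_act; case: arg_maxP (skips_feasible w) => //= b _ max_b _.
  exact: max_b.
apply: bigmax_le => //; apply: le_trans (H _ (skips_feasible w)).
rewrite /profit /play; move: (val w) => s /=.
elim: s T => [|i s IH] [|n] //=; rewrite ?big_nil // big_cons /= add0r; exact: IH.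
Qed.

Lemma expected_offline_profit_ge0 : 0 <= expected_offline_profit I.
Proof.
apply: sumr_ge0 => w _; rewrite mulr_ge0 ?offline_profit_ge0 //.
by apply: prodr_ge0 => t _; apply/ltW/mass_gt0.
Qed.

Lemma horizon_gt0 : (0 < T)%N.
Proof. by have := init_ge1 I; have := init_le_horizon I; lia. Qed.

(** [A i] and [S i] are the mean numbers of offline purchases and sales at tuple [i], divided by
    [T]. Each claim averages a bound that holds in every scenario; identical laws make the mean
    count of [i] equal to [T] times its mass. *)
Lemma offline_marginals : exists A S : 'I_(nsupp I) -> R,
  [/\ (forall i, 0 <= A i) /\ (forall i, 0 <= S i),
      forall i, A i + S i <= mass i,
      forall i, A i != 0 -> ((price i).1 < +oo)%E,
      \sum_i S i <= \sum_i A i + (init I)%:R / T%:R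
    & expected_offline_profit I <=
        T%:R * (\sum_i S i * sell i - \sum_i A i * buy i)].
Proof.
have T0 : 0 < T%:R :> R by rewrite ltr0n horizon_gt0.
have P0 (w : scenario I) : 0 <= scenario_prob w.
  by apply: prodr_ge0 => t _; apply/ltW/mass_gt0.
have P1 : \sum_(w : scenario I) scenario_prob w = 1.
  have := @expect_tuple _ _ (@mass _ I) T (fun=> 1).
  under eq_bigr do rewrite mulr1.
  by move=> ->; rewrite expect_cst // mass_sum1.
pose cnt w x i : R := (count_mem (i, x) (zip (val w) (val (offline_act w))))%:R.
pose M x i := (\sum_(w : scenario I) scenario_prob w * cnt w x i) / T%:R.
have sumM x (g : 'I_(nsupp I) -> R) : T%:R * (\sum_i M x i * g i) =
    \sum_(w : scenario I) scenario_prob w * \sum_i cnt w x i * g i.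
  under [RHS]eq_bigr do rewrite mulr_sumr.
  rewrite exchange_big mulr_sumr; apply: eq_bigr => i _ /=.
  rewrite /M mulrA [T%:R * _]mulrC divfK ?gt_eqF // mulr_suml.
  by apply: eq_bigr => w _; rewrite mulrA.
have sumM1 x : T%:R * (\sum_i M x i) =
    \sum_(w : scenario I) scenario_prob w * \sum_i cnt w x i.
  have := sumM x (fun=> 1); under eq_bigr do rewrite mulr1.
  by move=> ->; apply: eq_bigr => w _; congr (_ * _); apply: eq_bigr => i _; rewrite mulr1.
have M_ge0 x i : 0 <= M x i.
  by rewrite /M divr_ge0 ?(ltW T0) // sumr_ge0 // => w _; rewrite mulr_ge0.
exists (M Buy), (M Sell); split => //.
- move=> i; rewrite /M -mulrDl -big_split /= ler_pdivrMr //.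
  rewrite [leRHS]mulrC -(expect_count (mass_sum1 I)).
  rewrite -expect_tuple; apply: ler_sum => w _; rewrite -mulrDr.
  by apply: ler_wpM2l; rewrite ?P0 // -natrD ler_nat count_buy_sell_le.
- move=> i; rewrite /M; apply: contraR => pi.
  rewrite big1 ?mul0r // => w _; have [/eqP e|c0] := posnP (count_mem (i, Buy) (zip w (offline_act w))).
    by rewrite /cnt (eqP e) mulr0.
  case/negP: pi; apply: feasible_buy_fin c0.
  by rewrite -playE; exact: offline_act_feasible.
- rewrite -(ler_pM2l T0) mulrDr mulrCA divff ?gt_eqF // mulr1 !sumM1.
  have -> : (init I)%:R = \sum_(w : scenario I) scenario_prob w * (init I)%:R.
    by rewrite -mulr_suml P1 mul1r.
  rewrite -big_split /=.
  apply: ler_sum => w _; rewrite -mulrDr; apply: ler_wpM2l; first exact: P0.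
  rewrite /cnt -!natr_sum -natrD ler_nat addnC; apply: feasible_sell_le.
  by rewrite -playE; exact: offline_act_feasible.
- rewrite mulrBr !sumM -sumrB; apply: ler_sum => w _.
  rewrite -mulrBr; apply: ler_wpM2l; first exact: P0.
  by rewrite -profit_count -playE; exact: offline_profit_le.
Qed.

End OfflineMarginals.

(** * From the offline marginals to the guarantee (a) *)

Section UpperBound.
Variables (R : realType) (I : iid_instance R).
Local Notation T := (horizon I).
Local Notation B0 := (init I).
Local Notation buy i := (fine (price (i0 := I) i).1).
Local Notation sell i := ((price (i0 := I) i).2).

Lemma plan_rate (x y z : 'I_(nsupp I) -> R) :
  (forall i, 0 <= x i) -> (forall i, 0 <= y i) -> (forall i, 0 <= z i) ->
  (forall i, x i + y i + z i <= mass i) ->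
  (forall i, x i != 0 -> ((price i).1 < +oo)%E) ->
  \sum_i x i = \sum_i y i -> \sum_i z i <= B0%:R / T%:R ->
  0 <= \sum_i y i * sell i - \sum_i x i * buy i ->
  (1 - 2 / Num.sqrt B0%:R) * (T%:R *
    (\sum_i y i * sell i - \sum_i x i * buy i + \sum_i z i * sell i))
  <= opt_value I T B0.
Proof.
move=> x0 y0 z0 xyz xf xy zr D0.
have B0gt := init_ge1 I; have B0T := init_le_horizon I.
have Tgt : 0 < T%:R :> R by rewrite ltr0n; lia.
have Br : 0 < B0%:R :> R by rewrite ltr0n.
set q : R := Num.sqrt B0%:R; have qq : q ^+ 2 = B0%:R by rewrite sqr_sqrtr ?ltW.
have q0 : 0 < q by rewrite sqrtr_gt0.
(* [W] of order [sqrt B0] balances the refused fraction [1 / W] against the [W] copies taken from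
   the reserve. *)
have [W /andP[Wle Wgt]] := nat_sqrt B0.
have W0 : (0 < W)%N by case: W Wgt {Wle} => //; lia.
have WB : (W <= B0)%N by nia.
have Wq : W%:R <= q.
  rewrite -(ler_pXn2r (n := 2)) ?nnegrE ?(ltW q0) //.
  by rewrite qq -natrX ler_nat.
have qW : q <= 2 * W%:R.
  rewrite -(ler_pXn2r (n := 2)) ?nnegrE ?(ltW q0) ?mulr_ge0 //.
  by rewrite qq -natrM -natrX ler_nat; nia.
have r1 : B0%:R / T%:R <= 1 :> R by rewrite ler_pdivrMr // mul1r ler_nat.
have r0 : 0 < B0%:R / T%:R :> R by rewrite divr_gt0.
have W0B : (0 < W <= B0)%N by rewrite W0.
apply: le_trans (plan_le_opt x0 y0 z0 xyz xf xy zr r1 W0B).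
rewrite -/q; set D := _ - _ in D0 *; set Z := \sum_i z i * _.
have Z0 : 0 <= Z by apply: sumr_ge0 => i _; rewrite mulr_ge0 // sell_price_ge0.
have -> : (1 - 2 / q) * (T%:R * (D + Z)) =
  T%:R * (1 - 2 / q) * D + Z * (T%:R - T%:R * (2 / q)) by ring.
apply: lerD.
  rewrite ler_wpM2r // ler_pM2l // lerD2l lerN2.
  by rewrite ler_pdivlMr // mulrC ler_pdivrMr // ltr0n.
(* With [c = q], the variance term is at most [B0] and [(W + q)^2 <= 4 B0], within the allowance
   [8 B0] computed below. *)
apply: le_trans (reserve_ge r1 Z0 T (B0 - W) r0 q0).
rewrite ler_wpM2l // lerD2l lerN2.
have Tn0 : T%:R != 0 :> R by rewrite gt_eqF.
have TB : T%:R * (B0%:R / T%:R) = B0%:R :> R by rewrite mulrC divfK.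
rewrite TB natrB // ler_pdivrMr; last by rewrite mulr_gt0 // mulr_gt0.
have -> : T%:R * (2 / q) * (4 * q * (B0%:R / T%:R)) = 8 * B0%:R :> R.
  by field; rewrite Tn0 gt_eqF.
have Brho : 0 <= B0%:R * (B0%:R / T%:R) :> R by rewrite mulr_ge0 // ltW.
have W_ge0 : 0 <= W%:R :> R by [].
move: qq Brho; move: (B0%:R / T%:R) => rho; nra.
Qed.

(** The marginals must be turned into a plan whose buffered purchases and sales have equal rates,
    without lowering the gain [G]. *)
Lemma offline_rate :
  (1 - 2 / Num.sqrt B0%:R) * expected_offline_profit I <= opt_value I T B0.
Proof.
have [lt0|ge0] := ltrP (1 - 2 / Num.sqrt B0%:R : R) 0.
  apply: le_trans (opt_value_ge0 I T B0).
  by rewrite mulr_le0_ge0 ?(ltW lt0) // expected_offline_profit_ge0.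
have Tgt : 0 < T%:R :> R by rewrite ltr0n horizon_gt0.
have [A [S [[A0 S0] AS Af SA OPT]]] := offline_marginals I.
set G := _ - _ in OPT.
have G0 : 0 <= G.
  by rewrite -(pmulr_rge0 _ Tgt); apply: le_trans OPT; exact: expected_offline_profit_ge0.
suff [x [y [z [[x0 y0 z0] xyz xf [xy zr] [D0 GD]]]]] :
  exists x y z : 'I_(nsupp I) -> R,
  [/\ [/\ forall i, 0 <= x i, forall i, 0 <= y i & forall i, 0 <= z i],
      forall i, x i + y i + z i <= mass i,
      forall i, x i != 0 -> ((price i).1 < +oo)%E,
      \sum_i x i = \sum_i y i /\ \sum_i z i <= B0%:R / T%:R
    & 0 <= \sum_i y i * sell i - \sum_i x i * buy i /\
      G <= \sum_i y i * sell i - \sum_i x i * buy i + \sum_i z i * sell i].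
  apply: le_trans (plan_rate x0 y0 z0 xyz xf xy zr D0).
  by rewrite ler_wpM2l // (le_trans OPT) // ler_pM2l.
have pA0 : 0 <= \sum_i A i by apply: sumr_ge0.
have pS0 : 0 <= \sum_i S i by apply: sumr_ge0.
have XA0 : 0 <= \sum_i A i * buy i.
  by apply: sumr_ge0 => i _; rewrite mulr_ge0 // fine_ge0 // buy_price_ge0.
have XS0 : 0 <= \sum_i S i * sell i.
  by apply: sumr_ge0 => i _; rewrite mulr_ge0 // sell_price_ge0.
have scale (t : R) (F g : 'I_(nsupp I) -> R) :
    \sum_i t * F i * g i = t * \sum_i F i * g i.
  by rewrite mulr_sumr; apply: eq_bigr => i _; rewrite mulrA.
(* If purchases prevail, thin them out to the rate of the sales: this only saves money, and the
   reserve stays idle. *)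
have [le|gt] := lerP (\sum_i S i) (\sum_i A i).
  pose t := (\sum_i S i) / (\sum_i A i).
  have tA : t * \sum_i A i = \sum_i S i.
    (* Division by zero gives [t = 0], which is right since the sales then vanish too. *)
    have [e|?] := eqVneq (\sum_i A i) 0; last by rewrite divfK.
    by rewrite e mulr0; apply: le_anti; rewrite pS0 -[X in _ <= X]e.
  have t0 : 0 <= t by rewrite divr_ge0.
  have t1 : t <= 1.
    have [e|?] := eqVneq (\sum_i A i) 0; first by rewrite /t e invr0 mulr0.
    by rewrite ler_pdivrMr ?mul1r // lt_def pA0 andbT.
  exists (fun i => t * A i), S, (fun=> 0); split.
  - by split => // i; rewrite mulr_ge0.
  - move=> i; rewrite addr0; apply: le_trans (AS i); rewrite lerD2r.
    by rewrite ler_piMl.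
  - by move=> i; rewrite mulf_eq0 negb_or => /andP[_]; exact: Af.
  - split; first by rewrite -mulr_sumr.
    by rewrite sumr_const mul0rn divr_ge0.
  - rewrite scale; have : t * (\sum_i A i * buy i) <= \sum_i A i * buy i.
      by rewrite ler_piMl.
    move=> le'; have -> : \sum_(i < nsupp I) 0 * sell i = 0.
      by rewrite big1 // => i _; rewrite mul0r.
    by move: G0; rewrite /G; split; lra.
(* If sales prevail, a fraction [t] of each is matched with the purchases; the rest, of total rate
   at most [B0 / T], drains the reserve. *)
pose t := (\sum_i A i) / (\sum_i S i).
have S_gt0 : 0 < \sum_i S i by apply: le_lt_trans gt.
have tS : t * \sum_i S i = \sum_i A i by rewrite divfK // gt_eqF.
have t0 : 0 <= t by rewrite divr_ge0.
have t1 : 0 <= 1 - t by rewrite subr_ge0 ler_pdivrMr // mul1r ltW.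
have zr : \sum_i (1 - t) * S i <= B0%:R / T%:R by rewrite -mulr_sumr mulrBl mul1r tS; lra.
have z0 i : 0 <= (1 - t) * S i by rewrite mulr_ge0.
have [D0|D0] := lerP 0 (t * (\sum_i S i * sell i) - \sum_i A i * buy i).
  exists A, (fun i => t * S i), (fun i => (1 - t) * S i); split => //.
  - by split => // i; rewrite mulr_ge0.
  - by move=> i; have := AS i; lra.
  - by rewrite -[in X in _ = X]mulr_sumr tS.
  - by rewrite !scale; split => //; rewrite /G; lra.
(* The matched trades lose money here, so dropping them raises the gain. *)
exists (fun=> 0), (fun=> 0), (fun i => (1 - t) * S i); split => //.
- move=> i; rewrite !add0r; apply: le_trans (AS i).
  have := A0 i; have : 0 <= t * S i by rewrite mulr_ge0.
  lra.
- by move=> i; rewrite eqxx.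
- rewrite scale ![\sum_i 0 * _]big1; try by move=> i _; rewrite mul0r.
  by split; rewrite /G; lra.
Qed.

End UpperBound.

Lemma online_guarantee (R : realType) :
  exists C : R, 0 < C /\
     forall I : iid_instance R, (2 <= init I)%N ->
       exists A : online_alg I,
         (1 - C * (ln (init I)%:R / Num.sqrt (init I)%:R))
           * expected_offline_profit I <= expected_profit A.
Proof.
have ln2 : 0 < ln (2 : R) by rewrite ln_gt0 // ltr1n.
(* Since [ln B0 >= ln 2], the claimed loss is at least the loss [2 / sqrt B0] of [offline_rate]. *)
exists (2 / ln 2); split; first by rewrite divr_gt0.
move=> I I2; exists (opt_alg I); rewrite expected_profit_opt.
apply: le_trans (offline_rate I); apply: ler_wpM2r.
  exact: expected_offline_profit_ge0.
have s0 : 0 < Num.sqrt (init I)%:R :> R by rewrite sqrtr_gt0 ltr0n; lia.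
rewrite lerD2l lerN2 mulrA ler_pM2r ?invr_gt0 //.
rewrite mulrAC ler_pdivlMr // ler_pM2l //.
by rewrite ler_ln ?posrE ?ltr0n ?ler_nat //; lia.
Qed.

(** * Binomial tails *)

Lemma bin_le_central m i : ('C(2 * m, i) <= 'C(2 * m, m))%N.
Proof.
have up d : ('C(2 * m, m + d) <= 'C(2 * m, m))%N.
  elim: d => [|d IH]; first by rewrite addn0.
  apply: leq_trans IH; have := mul_bin_left (2 * m) (m + d).
  rewrite -addnS => e; have : (2 * m - (m + d) <= m + d.+1)%N by lia.
  by move=> /leq_mul /(_ (leqnn 'C(2 * m, m + d))); rewrite -e leq_pmul2l //; lia.
have [mi|im] := leqP m i; first by rewrite -(subnKC mi).
rewrite -bin_sub; last lia.
by have -> : (2 * m - i = m + (m - i))%N by lia.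
Qed.

Lemma central_bin_rec m :
  (m.+1 * 'C(2 * m.+1, m.+1) = 2 * (2 * m).+1 * 'C(2 * m, m))%N.
Proof.
have -> : (2 * m.+1 = (2 * m).+2)%N by lia.
rewrite binS -(bin_sub (m := m)); last lia.
have -> : ((2 * m).+1 - m = m.+1)%N by lia.
by have := mul_bin_diag (2 * m).+1 m; rewrite /=; lia.
Qed.

(** Equivalently [C(2m, m) / 4^m <= 1 / sqrt (2m + 1)]; the induction step amounts to
    [(2m + 1) (2m + 3) <= (2m + 2)^2]. *)
Lemma central_bin_sqr_le m : ('C(2 * m, m) ^ 2 * (2 * m).+1 <= 16 ^ m)%N.
Proof.
elim: m => [|m IH]; first by rewrite bin0.
have e := central_bin_rec m.
rewrite -(leq_pmul2l (m := m.+1 ^ 2)) ?expn_gt0 // mulnA -expnMn e [(16 ^ _)%N]expnS.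
move: IH; move: 'C(_, _) (16 ^ m)%N => c p /(leq_mul (leqnn (4 * (2 * m).+1 * (2 * m.+1).+1))) IH.
apply: (@leq_trans (4 * (2 * m).+1 * (2 * m.+1).+1 * p)); first by lia.
have le : (4 * (2 * m).+1 * (2 * m.+1).+1 <= m.+1 ^ 2 * 16)%N by lia.
by apply: leq_trans (leq_mul le (leqnn p)) _; lia.
Qed.

(** * Variance, symmetry and anti-concentration of a count *)

Section FairCount.
Variables (R : realFieldType) (k : nat) (mass : 'I_k -> R) (i0 : 'I_k).
Hypothesis mass_ge0 : forall i, 0 <= mass i.
Hypothesis mass_sum1 : \sum_i mass i = 1.

Lemma expect_var_count n :
  expect mass n (fun w => ((count_mem i0 w)%:R - n%:R * mass i0) ^+ 2) =
  n%:R * (mass i0 * (1 - mass i0)).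
Proof.
pose c i : R := (i == i0)%:R - mass i0.
have sum0 (g : 'I_k -> R) : \sum_i mass i * ((i == i0)%:R * g i) = mass i0 * g i0.
  rewrite (bigD1 i0) //= eqxx mul1r big1 ?addr0 // => i /negbTE ->.
  by rewrite mul0r mulr0.
have c0 : \sum_i mass i * c i = 0.
  under eq_bigr do rewrite /c mulrBr -[_%:R]mulr1.
  by rewrite sumrB sum0 -mulr_suml mass_sum1; ring.
have c2 : \sum_i mass i * c i ^+ 2 = mass i0 * (1 - mass i0).
  under eq_bigr => i _.
    rewrite (_ : c i ^+ 2 = (i == i0)%:R * (1 - 2 * mass i0) + mass i0 ^+ 2); last first.
      by rewrite /c; case: (i == i0) => /=; ring.
    rewrite mulrDr; over.
  by rewrite big_split /= sum0 -mulr_suml mass_sum1; ring.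
have := expect_sqr_sum mass_sum1 n 0 c0.
rewrite expr0n /= addr0 c2 => <-; apply: eq_expect => w sw; congr (_ ^+ 2).
rewrite addr0 /c sumrB big_const_seq count_predT sw iter_addr_0 mulr_natl.
congr (_ - _); elim: w {sw} => [|i w IH] /=; first by rewrite big_nil.
by rewrite big_cons natrD IH.
Qed.

Hypothesis mass_half : mass i0 = 2^-1.

Let mass_other : \sum_(i | i != i0) mass i = 2^-1.
Proof. by have := mass_sum1; rewrite (bigD1 i0) //= mass_half; lra. Qed.

Lemma fair_step n (f : nat -> R) :
  expect mass n.+1 (fun w => f (count_mem i0 w)) =
  2^-1 * expect mass n (fun w => f (count_mem i0 w).+1) +
  2^-1 * expect mass n (fun w => f (count_mem i0 w)).
Proof.
rewrite /= (bigD1 i0) //= eqxx mass_half; congr (_ + _).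
under eq_bigr => i /negbTE ii do rewrite ii.
by rewrite -mulr_suml mass_other.
Qed.

Lemma fair_sym n (f : nat -> R) :
  expect mass n (fun w => f (count_mem i0 w)) =
  expect mass n (fun w => f (n - count_mem i0 w)%N).
Proof.
elim: n f => [//|n IH] f.
rewrite fair_step (fair_step n (fun x => f (n.+1 - x)%N)) addrC; congr (_ * _ + _ * _).
  by rewrite IH; apply: eq_expect => w _; rewrite subSS.
rewrite (IH (fun x => f x.+1)); apply: eq_expect => w sw.
by rewrite subSn // -sw count_size.
Qed.

Lemma fair_pmf n t :
  expect mass n (fun w => (count_mem i0 w == t)%:R) = 'C(n, t)%:R / 2 ^+ n.
Proof.
elim: n t => [|n IH] [|t]; rewrite ?bin0 ?bin0n /= ?expr0 ?divr1 //.
  apply: etrans (fair_step n (fun x => (x == 0%N)%:R)) _.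
  by rewrite IH bin0 /= (expect_cst mass_sum1) mulr0 add0r exprS !mul1r invfM.
apply: etrans (fair_step n (fun x => (x == t.+1)%:R)) _; rewrite IH.
rewrite (_ : expect _ _ _ = 'C(n, t)%:R / 2 ^+ n); last by rewrite -IH.
by rewrite -mulrDr -mulrDl binS natrD addrC exprS invfM mulrCA mulrA.
Qed.

(** The tails are equally likely by symmetry. The at most [2 s] values between them have chance at
    most [cb] each, and [s cb <= 1/8], so each tail keeps [(1 - 1/4) / 2 = 3/8]. *)
Lemma fair_tail m s : (64 * s ^ 2 <= (2 * m).+1)%N ->
  3 / 8 <= expect mass (2 * m) (fun w => (m + s <= count_mem i0 w)%N%:R) /\
  3 / 8 <= expect mass (2 * m) (fun w => (count_mem i0 w + s <= m)%N%:R).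
Proof.
move=> s64; set hi := expect _ _ _; set lo := expect _ _ _.
have hilo : hi = lo.
  rewrite /hi (fair_sym _ (fun x => (m + s <= x)%N%:R)); apply: eq_expect => w sw.
  have := count_size (pred1 i0) w; rewrite sw => cw.
  by congr (nat_of_bool _)%:R; apply/idP/idP; lia.
pose cb : R := 'C(2 * m, m)%:R / 2 ^+ (2 * m).
have cb0 : 0 <= cb by rewrite divr_ge0 // exprn_ge0.
have window : 1 <= hi + lo + \sum_(d < 2 * s) cb.
  rewrite -{1}(expect_cst mass_sum1 (2 * m) 1).
  have -> : \sum_(d < 2 * s) cb = expect mass (2 * m) (fun=> \sum_(d < 2 * s) cb).
    by rewrite expect_cst.
  apply: (@le_trans _ _ (hi + lo + expect mass (2 * m)
      (fun w => \sum_(d < 2 * s) (count_mem i0 w + s == m + d)%N%:R))).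
    rewrite /hi /lo -!expectD; apply: le_expect => // w _.
    have [?|h] := leqP (m + s) (count_mem i0 w).
      by rewrite -addrA lerDl addr_ge0 // sumr_ge0.
    have [?|l] := leqP (count_mem i0 w + s) m.
      by rewrite add0r lerDl sumr_ge0.
    have d : (count_mem i0 w + s - m < 2 * s)%N by lia.
    have e : (count_mem i0 w + s == m + (count_mem i0 w + s - m))%N by lia.
    rewrite (bigD1 (Ordinal d)) //= e.
    by rewrite !add0r lerDl sumr_ge0.
  rewrite lerD2l expect_cst //; elim: (2 * s)%N => [|S IH].
    by rewrite big_ord0 (@eq_expect _ _ _ _ _ (fun=> 0)) ?expect_cst // => w _; rewrite big_ord0.
  under eq_expect => w _ do rewrite big_ord_recr /=.
  rewrite expectD [leRHS]big_ord_recr /= lerD //.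
  have [mS|mS] := leqP s (m + S); last first.
    rewrite (@eq_expect _ _ _ _ _ (fun=> 0)) ?expect_cst // => w _.
    by have -> : (count_mem i0 w + s == m + S)%N = false by lia.
  rewrite (@eq_expect _ _ _ _ _ (fun w => (count_mem i0 w == m + S - s)%N%:R)); last first.
    by move=> w _; rewrite -[in RHS](eqn_add2r s) subnK.
  rewrite fair_pmf /cb ler_wpM2r ?invr_ge0 ?exprn_ge0 // ler_nat.
  exact: bin_le_central.
have scb : s%:R * cb <= 8^-1.
  have s0 : 0 <= s%:R * cb by rewrite mulr_ge0.
  rewrite -(ler_pXn2r (n := 2)) ?nnegrE // ?invr_ge0 //.
  have cb1 : cb ^+ 2 * (2 * m).+1%:R <= 1.
    rewrite /cb expr_div_n mulrAC ler_pdivrMr ?mul1r; last by rewrite !exprn_gt0.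
    have -> : (2 ^+ (2 * m)) ^+ 2 = 16%:R ^+ m :> R.
      by rewrite -exprM mulnAC exprM -natrX.
    by rewrite -!natrX -natrM ler_nat central_bin_sqr_le.
  have : 64 * s%:R ^+ 2 <= (2 * m).+1%:R :> R by rewrite -natrX -natrM ler_nat.
  move=> /(ler_wpM2l (sqr_ge0 cb)) h; rewrite exprMn exprVn.
  by have := le_trans h cb1; lra.
move: window; rewrite sumr_const card_ord -[cb *+ _]mulr_natl natrM -hilo; split; lra.
Qed.

End FairCount.

(** * The two-price instance *)

(* Best profit with [k] copies when [N] requests pay 2 and [K] requests pay 1. *)
Definition two_price_profit (N K k : nat) : nat :=
  (2 * minn N k + minn K (k - N))%N.

Lemma two_price_profit_mono N K k : (two_price_profit N K k <= two_price_profit N K k.+1)%N.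
Proof. by rewrite /two_price_profit; lia. Qed.

Lemma two_price_profit_split N1 K1 N2 K2 M h k :
  (M <= K1)%N -> (h <= N1)%N -> (M + h <= k)%N ->
  (M + 2 * h + two_price_profit N2 K2 (k - M - h) <= two_price_profit (N1 + N2) (K1 + K2) k)%N.
Proof. by rewrite /two_price_profit; lia. Qed.

(** Price-2 requests can absorb the whole stock, so each early sale at 1 displaces a sale at 2. *)
Lemma two_price_loss_full N1 K1 N2 K2 M h k :
  (M <= K1)%N -> (h <= N1)%N -> (M + h <= k)%N -> (k <= N1 + N2)%N ->
  (M + 2 * h + two_price_profit N2 K2 (k - M - h) + M <= two_price_profit (N1 + N2) (K1 + K2) k)%N.
Proof. by rewrite /two_price_profit; lia. Qed.

(** Stock remains for [c] early sales at 1 besides all other useful ones, so each of them that is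
    refused forgoes 1. *)
Lemma two_price_loss_room N1 K1 N2 K2 M h k c :
  (M <= K1)%N -> (h <= N1)%N -> (M + h <= k)%N -> (c <= K1)%N -> (N1 + N2 + c + K2 <= k)%N ->
  (M + 2 * h + two_price_profit N2 K2 (k - M - h) + (c - M) <= two_price_profit (N1 + N2) (K1 + K2) k)%N.
Proof. by rewrite /two_price_profit; lia. Qed.

Section HardInstance.
Variables (R : realType) (n T : nat) (d : R).
Hypotheses (n_gt0 : (0 < n)%N) (n_le_T : (n <= T)%N).
Hypotheses (d_gt0 : 0 < d) (d_lt : d < 2^-1).

Let hprice (i : 'I_3) : price_tuple R := (+oo%E, (2 - i)%:R).
Let hmass (i : 'I_3) : R :=
  if i == 0%N :> nat then 2^-1 else if i == 1%N :> nat then d else 2^-1 - d.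

Let hprice_inj : injective hprice.
Proof.
move=> i j [] /eqP; rewrite eqr_nat => /eqP e; apply: val_inj => /=.
by have := ltn_ord i; have := ltn_ord j; lia.
Qed.
Let hbuy_ge0 i : (0 <= (hprice i).1)%E. Proof. by rewrite /= leey. Qed.
Let hsell_ge0 i : 0 <= (hprice i).2. Proof. exact: ler0n. Qed.
Let hmass_gt0 i : 0 < hmass i.
Proof. by rewrite /hmass; do 2?case: ifP => // _; rewrite ?invr_gt0 ?subr_gt0. Qed.
Let hmass_sum1 : \sum_i hmass i = 1.
Proof. by rewrite !big_ord_recl big_ord0 /hmass /=; lra. Qed.
Let hcap : (n <= n + T)%N. Proof. exact: leq_addr. Qed.

Definition hard : iid_instance R :=
  IidInstance hprice_inj hbuy_ge0 hsell_ge0 hmass_gt0 hmass_sum1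
    n_gt0 n_gt0 (leqnn n) n_le_T hcap.

Local Notation E m := (expect hmass m).
Local Notation i0 := (@ord0 2).
Local Notation i1 := (lift ord0 (@ord0 1)).
Local Notation H w := (count_mem i0 w).
Local Notation L w := (count_mem i1 w).
Let hmass_ge0 i : 0 <= hmass i. Proof. exact/ltW/hmass_gt0. Qed.

Let two_price_cons (i : 'I_3) w k :
  ((2 - i) * (0 < k) + two_price_profit (H w) (L w) k.-1 <=
   two_price_profit (H (i :: w)) (L (i :: w)) k)%N /\
  (two_price_profit (H w) (L w) k <= two_price_profit (H (i :: w)) (L (i :: w)) k)%N.
Proof.
rewrite /two_price_profit /=.
by case: i => [[|[|[|i]]] hi] //=; rewrite -?val_eqE /=; lia.
Qed.

Lemma opt_value_le_offline m k :
  opt_value hard m k <= E m (fun w => (two_price_profit (H w) (L w) k)%:R).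
Proof.
elim: m k => [|m IH] k; first by rewrite /= ler0n.
apply: ler_sum => i _; apply: ler_wpM2l; first exact: hmass_ge0.
have := best_allowed hard (opt_value hard m) k (hprice i).
rewrite -[X in allowed _ _ X]/(price (i0 := hard) i).
case: (best _ _ _ _) => /=; first by rewrite andbF.
  move=> k0; apply: le_trans (lerD (lexx _) (IH _)) _.
  rewrite -(expect_cst hmass_sum1 m (2 - i)%:R) -expectD.
  apply: le_expect => // w _; rewrite -natrD ler_nat.
  by have [+ _] := two_price_cons i w k; rewrite k0 muln1.
move=> _; rewrite add0r; apply: le_trans (IH _) _.
apply: le_expect => // w _; rewrite ler_nat.
by have [_ +] := two_price_cons i w k.
Qed.

(* The online algorithm may choose with hindsight how many copies [M] and [h] to
   sell at 1 and at 2 in the first phase, and is then replaced by the offline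
   one. *)
Lemma opt_value_two_phases m1 m2 k (F : seq 'I_3 -> R) :
  (forall w M h, size w = m1 -> (M <= L w)%N -> (h <= H w)%N -> (M + h <= k)%N ->
    (M + 2 * h)%:R + E m2 (fun v => (two_price_profit (H v) (L v) (k - M - h))%:R)
      <= F w) ->
  opt_value hard (m1 + m2) k <= E m1 F.
Proof.
elim: m1 k F => [|m1 IH] k F HF.
  have := HF [::] 0%N 0%N erefl isT isT isT; rewrite !subn0 add0r.
  exact: le_trans (opt_value_le_offline _ _).
apply: ler_sum => i _; apply: ler_wpM2l; first exact: hmass_ge0.
have := best_allowed hard (opt_value hard (m1 + m2)) k (hprice i).
rewrite -[X in allowed _ _ X]/(price (i0 := hard) i).
case: (best _ _ _ _) => /=; first by rewrite andbF.
  move=> k0; rewrite -lerBrDl.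
  rewrite -[X in _ - X](expect_cst hmass_sum1 m1) -expectB.
  apply: IH => w M h sw Mw hw Mhk; rewrite lerBrDl.
  have := HF (i :: w); case: i => [[|[|[|i]]] hi] //=; rewrite -?val_eqE /= => HFi.
  - have le : (M + h.+1 <= k)%N by lia.
    apply: le_trans (HFi M h.+1 (congr1 S sw) Mw hw le).
    by rewrite (_ : (k - M - h.+1 = k.-1 - M - h)%N) ?addrA -?natrD ?lerD2r ?ler_nat; lia.
  - have le : (M.+1 + h <= k)%N by lia.
    apply: le_trans (HFi M.+1 h (congr1 S sw) Mw hw le).
    by rewrite (_ : (k - M.+1 - h = k.-1 - M - h)%N) ?addrA -?natrD ?lerD2r ?ler_nat; lia.
  (* A sale at price 0 wastes a copy: keeping it cannot lower the later profit. *)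
  - have le : (M + h <= k)%N by lia.
    apply: le_trans (HFi M h (congr1 S sw) Mw hw le).
    rewrite add0r lerD2l; apply: le_expect => // v _.
    by rewrite ler_nat (_ : (k - M - h = (k.-1 - M - h).+1)%N) ?two_price_profit_mono; lia.
move=> _; rewrite add0r; apply: IH => w M h sw Mw hw Mhk.
by apply: HF; rewrite /= ?sw //; apply: leq_trans (leq_addl _ _).
Qed.

(** The formula is attained by selling at a positive price whenever its recursion allows this sale,
    and skipping otherwise. *)
Lemma offline_ge : E T (fun w => (two_price_profit (H w) (L w) n)%:R)
  <= expected_offline_profit hard.
Proof.
rewrite -expect_tuple; apply: ler_sum => w _.
apply: ler_wpM2l; first by apply: prodr_ge0 => t _; exact: hmass_ge0.
suff [a sa [fa pa]] : exists2 a : seq action, size a = T &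
    feasible n n (zip [seq hprice i | i <- w] a) /\
    profit (zip [seq hprice i | i <- w] a) = (two_price_profit (H w) (L w) n)%:R.
  have sa' : size a == T by apply/eqP.
  rewrite -pa.
  exact: (@Order.TotalTheory.le_bigmax_cond _ _ _ _ (Tuple sa') (fun a : actions hard => feasible n n (play (w : scenario hard) a)) (fun a : actions hard => profit (play (w : scenario hard) a))).
have sw := size_tuple w; move: (val w) sw => s.
move: {1}n => B; move: T n => m k.
elim: s m k => [|i s IH] m k <-.
  by exists [::] => //; rewrite /profit big_nil /two_price_profit !min0n.
have act x k' : allowed B k (hprice i) x -> k' = next_stock k x ->
    (two_price_profit (H (i :: s)) (L (i :: s)) k)%:R =
      gain (hprice i) x + (two_price_profit (H s) (L s) k')%:R ->
  exists2 a, size a = size (i :: s) &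
    feasible B k (zip [seq hprice i | i <- i :: s] a) /\
    profit (zip [seq hprice i | i <- i :: s] a) =
    (two_price_profit (H (i :: s)) (L (i :: s)) k)%:R.
  move=> al k'E ->; have [a sa [fa pa]] := IH _ k' erefl.
  exists (x :: a); first by rewrite /= sa.
  split; first by rewrite /= al -k'E.
  by rewrite -pa /profit /= big_cons.
have [Hk|Hk] := boolP ((0 < 2 - i) && (two_price_profit (H (i :: s)) (L (i :: s)) k ==
   2 - i + two_price_profit (H s) (L s) k.-1) && (0 < k))%N.
  move/andP: Hk => [/andP[_ /eqP e] k0].
  by apply: (act Sell k.-1) => //=; rewrite e natrD.
apply: (act Skip k) => //; rewrite add0r; congr _%:R.
move: Hk; rewrite /two_price_profit /=.
case: i {act} => [[|[|[|i]]] hi] //=; lia.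
Qed.

Lemma offline_le : expected_offline_profit hard <= (2 * n)%:R.
Proof.
rewrite -(expect_cst hmass_sum1 T (2 * n)%:R) -expect_tuple.
apply: ler_sum => w _; apply: ler_wpM2l; first by apply: prodr_ge0 => t _.
apply: bigmax_le; rewrite ?ler0n // => a.
rewrite /play; move: (val w) (val a) => s {}a.
rewrite [capacity _]/= [init _]/=; move: {1}n => B; move: n => k.
elim: s a k => [|i s IH] [|x a] k; try by rewrite /profit big_nil ler0n.
rewrite /= => /andP[al /IH]; rewrite /profit big_cons /=.
case: x al => /=; first by rewrite andbF.
  move=> k0 le; apply: le_trans (lerD (lexx _) le) _.
  by rewrite -natrD ler_nat; lia.
by rewrite add0r.
Qed.

(** After a typical first phase, a late deviation of [s + c + s'] upwards exhausts the stock and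
    costs [M]; downwards, with at most [s'] late requests of price 1, it costs [c - M]. The chances
    are at least 3/8 and [3/8 - 1/8], so the loss is at least [c / 4]. *)
Lemma two_phase_regret j m s c s' w M h :
  n = (j + m)%N -> (s + c + s' > 0)%N ->
  (64 * (s + c + s') ^ 2 <= (2 * m).+1)%N ->
  8 * ((2 * m)%:R * d) <= s'.+1%:R ->
  (j <= H w + s)%N -> (H w <= j + s)%N -> (c <= L w)%N ->
  (M <= L w)%N -> (h <= H w)%N -> (M + h <= n)%N ->
  (M + 2 * h)%:R + E (2 * m) (fun v => (two_price_profit (H v) (L v) (n - M - h))%:R)
  <= E (2 * m) (fun v => (two_price_profit (H (w ++ v)) (L (w ++ v)) n)%:R) - c%:R / 4.
Proof.
move=> nE S0 S64 s'd Hlo Hhi cL ML hH Mhn.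
have mass0 : hmass i0 = 2^-1 by [].
have [tail_hi tail_lo] := fair_tail hmass_ge0 hmass_sum1 mass0 S64.
pose full v := (m + (s + c + s') <= H v)%N.
pose low v := (H v + (s + c + s') <= m)%N.
pose many v := (s' < L v)%N.
have many_le : E (2 * m) (fun v => (many v)%:R) <= 8^-1.
  apply: le_trans (expect_markov hmass_ge0 (n := 2 * m) (P := many)
    (F := fun v => (L v)%:R) (a := s'.+1%:R) _ _ _) _ => //.
    by move=> v _; rewrite /many ler_nat.
  rewrite (expect_count hmass_sum1) ler_pdivrMr //.
  by rewrite (_ : hmass _ = d) //; lra.
(* [low - many] bounds the indicator of [low && ~~ many] from below, which keeps the inequality
   linear under expectation. *)
have key v : (M + 2 * h)%:R + (two_price_profit (H v) (L v) (n - M - h))%:R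
    + M%:R * (full v)%:R + (c - M)%N%:R * ((low v)%:R - (many v)%:R)
    <= (two_price_profit (H (w ++ v)) (L (w ++ v)) n)%:R :> R.
  rewrite !count_cat.
  have base := two_price_profit_split (H v) (L v) ML hH Mhn.
  have [fv|nfv] := boolP (full v).
    have lv : low v = false by apply/negbTE; move: fv; rewrite /full /low; lia.
    have full_n : (n <= H w + H v)%N by move: fv; rewrite /full; lia.
    have := two_price_loss_full (L v) ML hH Mhn full_n.
    rewrite -(ler_nat R) !natrD lv mulr1 => le; apply: le_trans le.
    by rewrite sub0r gerDl mulrN oppr_le0 mulr_ge0.
  rewrite mulr0 addr0.
  have [/andP[lv mv]|] := boolP (low v && ~~ many v); last first.
    move=> /negP nlm; move: base; rewrite -(ler_nat R) natrD => base.
    apply: le_trans base; rewrite gerDl mulr_ge0_le0 // subr_le0 ler_nat.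
    by move: nlm; case: (low v) (many v) => [] [].
  have room : (H w + H v + c + L v <= n)%N by move: lv mv; rewrite /low /many; lia.
  have := two_price_loss_room ML hH Mhn cL room.
  by rewrite lv (negbTE mv) subr0 mulr1 -natrD -natrD ler_nat.
have := le_expect hmass_ge0 (n := 2 * m) (fun v _ => key v).
rewrite !expectD !expectZ expectB expect_cst //.
have c_le : c%:R <= M%:R + (c - M)%N%:R :> R by rewrite -natrD ler_nat; lia.
have M0 : 0 <= M%:R :> R by [].
have cM0 : 0 <= (c - M)%N%:R :> R by [].
move: tail_hi tail_lo many_le; rewrite -/full -/low.
set a := E _ _; set b := E _ _; set e := E _ _; move=> a38 b38 e8.
have : M%:R * (3 / 8) <= M%:R * a by rewrite ler_wpM2l.
have : (c - M)%N%:R * (1 / 4) <= (c - M)%N%:R * (b - e) by rewrite ler_wpM2l //; lra.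
lra.
Qed.

(** The first phase is [good] with chance at least 1/2, by Chebyshev's inequality; elsewhere
    hindsight merely dominates. This halves the loss [c / 4]. *)
Lemma regret j m s c s' :
  n = (j + m)%N -> T = (2 * j + 2 * m)%N -> (0 < s)%N -> (8 <= c)%N ->
  (2 * j <= s ^ 2)%N -> (2 * j)%:R * d = (2 * c)%:R ->
  (64 * (s + c + s') ^ 2 <= (2 * m).+1)%N ->
  8 * ((2 * m)%:R * d) <= s'.+1%:R ->
  opt_value hard T n <= expected_offline_profit hard - c%:R / 8.
Proof.
move=> nE TE s0 c8 js jd S64 s'd.
have S0 : (0 < s + c + s')%N by lia.
pose good w := [&& (j <= H w + s)%N, (H w <= j + s)%N & (c <= L w)%N].
pose F w := E (2 * m) (fun v => (two_price_profit (H (w ++ v)) (L (w ++ v)) n)%:R)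
  - c%:R / 4 * (good w)%:R.
have value_le : opt_value hard T n <= E (2 * j) F.
  rewrite TE; apply: opt_value_two_phases => w M h sw ML hH Mhn.
  rewrite /F; have [/and3P[Hlo Hhi cL]|_] := boolP (good w).
    by rewrite mulr1; apply: (two_phase_regret nE S0 S64 s'd).
  rewrite mulr0 subr0 -[X in X + _](expect_cst hmass_sum1 (2 * m)) -expectD.
  apply: le_expect => // v _; rewrite -natrD ler_nat !count_cat.
  exact: two_price_profit_split.
have good_ge : 2^-1 <= E (2 * j) (fun w => (good w)%:R).
  pose dev w := ~~ ((j <= H w + s)%N && (H w <= j + s)%N).
  pose few w := (L w < c)%N.
  have cover : 1 <= E (2 * j) (fun w => (good w)%:R) + E (2 * j) (fun w => (dev w)%:R)
      + E (2 * j) (fun w => (few w)%:R).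
    rewrite -{1}(expect_cst hmass_sum1 (2 * j) 1) -!expectD.
    apply: le_expect => // w _; rewrite /good /dev /few ltnNge.
    case: (_ <= _)%N (_ <= _)%N (_ <= _)%N => [] [] [] /=; lra.
  have s2 : 0 < s%:R ^+ 2 :> R by rewrite exprn_gt0 // ltr0n.
  have c2 : 0 < c%:R ^+ 2 :> R by rewrite exprn_gt0 // ltr0n; lia.
  have dev_le : E (2 * j) (fun w => (dev w)%:R) <= 4^-1.
    apply: le_trans (expect_markov hmass_ge0 (n := 2 * j) (P := dev)
      (F := fun w => ((H w)%:R - (2 * j)%:R * hmass i0) ^+ 2) s2 _ _) _.
    - by move=> w _; exact: sqr_ge0.
    - move=> w _; rewrite /dev (_ : hmass i0 = 2^-1) // natrM mulrAC divff ?pnatr_eq0 // mul1r.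
      rewrite negb_and -!ltnNge => /orP[] lt.
        have : (H w)%:R + s%:R <= j%:R :> R by rewrite -natrD ler_nat ltnW.
        by have : 0 <= s%:R :> R by []; nra.
      have : j%:R + s%:R <= (H w)%:R :> R by rewrite -natrD ler_nat ltnW.
      by have : 0 <= s%:R :> R by []; nra.
    rewrite (expect_var_count i0 hmass_sum1) (_ : hmass i0 = 2^-1) // ler_pdivrMr //.
    have : (2 * j)%:R <= s%:R ^+ 2 :> R by rewrite -natrX ler_nat.
    lra.
  (* The mean is [2 c] and the variance at most [2 c], so the chance is at most [2 / c], and
     [8 <= c]. *)
  have few_le : E (2 * j) (fun w => (few w)%:R) <= 4^-1.
    apply: le_trans (expect_markov hmass_ge0 (n := 2 * j) (P := few)
      (F := fun w => ((L w)%:R - (2 * j)%:R * hmass i1) ^+ 2) c2 _ _) _.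
    - by move=> w _; exact: sqr_ge0.
    - move=> w _; rewrite /few (_ : hmass i1 = d) // jd natrM => lt.
      have : (L w)%:R <= c%:R :> R by rewrite ler_nat ltnW.
      by have : 0 <= c%:R :> R by []; nra.
    rewrite (expect_var_count i1 hmass_sum1) (_ : hmass i1 = d) // ler_pdivrMr // mulrA jd.
    have : 8 <= c%:R :> R by rewrite ler_nat.
    have d0 := d_gt0; rewrite natrM; nra.
  lra.
apply: le_trans value_le _; rewrite /F expectB expectZ.
rewrite -(expect_cat hmass _ _ (fun w => (two_price_profit (H w) (L w) n)%:R)) -TE.
apply: lerB; first exact: offline_ge.
have : 0 <= c%:R :> R by [].
nra.
Qed.

End HardInstance.

(* The phases have lengths [2 j] and [2 (n - j)] with [j = 2 b^2], and a request
   pays 1 with probability [q / j]. *)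
Lemma hard_parameters beta n :
  (80 * 80 <= beta)%N -> ((40 * beta * 8) ^ 2 <= n)%N ->
  exists q b, let j := (2 * b ^ 2)%N in
  [/\ (8 <= q)%N /\ (0 < b)%N, (j <= n)%N /\ (2 * q < j)%N,
      (64 * (2 * b + q + 4 * b) ^ 2 <= (2 * (n - j)).+1)%N,
      (8 * (2 * (n - j) * q) <= (4 * b).+1 * j)%N
    & (n <= (80 * beta * q) ^ 2)%N].
Proof.
move=> beta_ge n_ge.
have D0 : (0 < (40 * beta) ^ 2)%N by rewrite expn_gt0 muln_gt0; lia.
(* [q] is about [sqrt n / (40 beta)] and [b = beta q] about [sqrt n / 40]; a large [beta] makes [q]
   small against [b]. *)
have [q /andP[ql qu]] := nat_sqrt (n %/ (40 * beta) ^ 2).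
have q8 : (8 <= q)%N.
  rewrite -ltnS -(@ltn_exp2r _ _ 2) //; apply: leq_ltn_trans qu.
  by rewrite leq_divRL // mulnC -expnMn.
have qn : ((40 * beta * q) ^ 2 <= n)%N by rewrite expnMn mulnC -leq_divRL.
have nq : (n < (40 * beta * q.+1) ^ 2)%N by rewrite expnMn mulnC -ltn_divLR.
have nq2 : (n <= (40 * beta) ^ 2 * (2 * q ^ 2))%N.
  apply: leq_trans (ltnW nq) _; rewrite expnMn leq_mul2l; apply/orP; right.
  by clear - q8; nia.
have b_ge : (80 * 80 * q <= beta * q)%N by rewrite leq_mul2r beta_ge orbT.
have b2n : (1600 * (beta * q) ^ 2 <= n)%N.
  by apply: leq_trans qn; clear; rewrite -mulnA (expnMn 40); lia.
have nb2 : (n <= 3200 * (beta * q) ^ 2)%N.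
  by apply: leq_trans nq2 _; clear; rewrite !expnMn; lia.
have q2 : ((80 * beta * q) ^ 2 = 4 * (40 * beta) ^ 2 * q ^ 2)%N.
  by clear; rewrite !expnMn; lia.
exists q, (beta * q)%N; rewrite q2 /=.
move: (beta * q)%N b_ge b2n nb2 => b b_ge b2n nb2.
(* After division by [j = 2 b^2], the mean number of late requests of price 1 is at most [b / 2]. *)
have nqb : (2 * n * q <= b ^ 3)%N.
  apply: (@leq_trans (2 * q * (3200 * b ^ 2))).
    by rewrite mulnAC leq_mul2l nb2 orbT.
  apply: (@leq_trans (b * b ^ 2)); last by rewrite -expnS.
  by rewrite mulnA leq_mul2r; apply/orP; right; clear - b_ge; lia.
have b0 : (0 < b)%N by clear - b_ge q8; lia.
split => //.
- split; first by clear - b2n; lia.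
  by rewrite ltn_pmul2l //; clear - b_ge q8; nia.
(* The deviation is at most [7 b], and [64 * 49 = 3136] is below [2 (1600 - 2) = 3196]. *)
- apply: (@leq_trans (64 * (7 * b) ^ 2)).
    by rewrite leq_pmul2l // leq_exp2r //; clear - b_ge; lia.
  by rewrite expnMn; clear - b2n; lia.
- apply: (@leq_trans (8 * (2 * n * q))).
    by rewrite leq_pmul2l // leq_mul2r leq_mul2l leq_subr !orbT.
  apply: (@leq_trans (8 * b ^ 3)); first by rewrite leq_pmul2l.
  by rewrite mulSn (expnS b 2); clear; lia.
- by apply: leq_trans nq2 _; clear; lia.
Qed.

Lemma online_gap (R : realType) :
  exists (c : R) (n0 : nat), 0 < c /\
     forall B0 : nat, (n0 <= B0)%N ->
       exists I : iid_instance R,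
         [/\ init I = B0,
             0 < expected_offline_profit I
           & forall A : online_alg I,
               expected_profit A
                 <= (1 - c / Num.sqrt B0%:R) * expected_offline_profit I].
Proof.
have [beta beta_ge] : exists beta, (80 * 80 <= beta)%N by exists (80 * 80)%N.
have beta0 : 0 < beta%:R :> R by rewrite ltr0n; lia.
(* The regret is [q / 8], while [OPT <= 2 n] and [sqrt n <= 80 beta q]; hence
   [1280 = 8 * 2 * 80]. *)
exists (1280 * beta%:R)^-1, ((40 * beta * 8) ^ 2)%N; split.
  by rewrite invr_gt0 mulr_gt0.
move=> n n_ge.
have [q [b [[q8 b0] [jn qj] S64 bjq nq]]] := hard_parameters beta_ge n_ge.
pose j := (2 * b ^ 2)%N; pose m := (n - j)%N.
have j0 : (0 < j)%N by apply: leq_ltn_trans qj.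
have nE : n = (j + m)%N by rewrite /m subnKC.
have jr : 0 < j%:R :> R by rewrite ltr0n.
pose d : R := q%:R / j%:R.
have d0 : 0 < d by rewrite divr_gt0 // ltr0n; lia.
have d2 : d < 2^-1.
  by rewrite ltr_pdivrMr // mulrC ltr_pdivlMr // mulrC -natrM ltr_nat.
have n0 : (0 < n)%N by lia.
have nT : (n <= 2 * j + 2 * m)%N by lia.
pose I := hard n0 nT d0 d2.
have reg : opt_value I (2 * j + 2 * m) n <= expected_offline_profit I - q%:R / 8.
  apply: (@regret R n _ d n0 nT d0 d2 j m (2 * b) q (4 * b)) => //.
  - by rewrite muln_gt0.
  - by rewrite expnMn mulnA.
  - by rewrite /d mulrC natrM mulrCA divfK ?gt_eqF // -natrM.
  - by rewrite /d mulrA mulrA ler_pdivrMr // -!natrM ler_nat -mulnA.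
have q0 : 0 < q%:R :> R by rewrite ltr0n; lia.
have OPT_ge := opt_value_ge0 I (2 * j + 2 * m) n.
have OPT_le : expected_offline_profit I <= (2 * n)%:R by exact: offline_le.
(* The nonnegative online value is at most [OPT - q / 8]. *)
have OPT0 : 0 < expected_offline_profit I by lra.
exists I; split => // A.
apply: le_trans (expected_profit_le_opt A) _; apply: le_trans reg _.
rewrite mulrBl mul1r lerD2l lerN2.
set s : R := Num.sqrt n%:R.
have s2 : s ^+ 2 = n%:R by rewrite sqr_sqrtr.
have s0 : 0 < s by rewrite sqrtr_gt0 ltr0n.
have sq : s <= 80 * beta%:R * q%:R.
  rewrite -(ler_pXn2r (n := 2)) ?nnegrE ?(ltW s0) ?mulr_ge0 // s2.
  by rewrite -!natrM -natrX ler_nat.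
rewrite mulrAC ler_pdivrMr // mulrC ler_pdivrMr ?mulr_gt0 //.
move: OPT_le; rewrite natrM -s2; nra.
Qed.

Theorem theorem1p4 (R : realType) :
  (exists C : R, 0 < C /\
     forall I : iid_instance R, (2 <= init I)%N ->
       exists A : online_alg I,
         (1 - C * (ln (init I)%:R / Num.sqrt (init I)%:R))
           * expected_offline_profit I <= expected_profit A)
  /\
  (exists (c : R) (n0 : nat), 0 < c /\
     forall B0 : nat, (n0 <= B0)%N ->
       exists I : iid_instance R,
         [/\ init I = B0,
             0 < expected_offline_profit I
           & forall A : online_alg I,
               expected_profit A
                 <= (1 - c / Num.sqrt B0%:R) * expected_offline_profit I]).
Proof. by split; [exact: online_guarantee | exact: online_gap]. Qed.
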